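(* Let $n$ be a positive integer and let $q$ be a prime power. Let $a\in U(\mathbb{F}_q)$ and $b\in N(\mathbb{F}_q)$. Then $$|ST_n(\mathbb{F}_q,a)|=\begin{cases}|ST_n(\mathbb{F}_q,1)| & \text{if } a\in Q(\mathbb{F}_q),\\ |ST_n(\mathbb{F}_q,b)| & \text{if } a\in N(\mathbb{F}_q).\end{cases}$$
   Context: $\mathbb{F}_q$ is the finite field with $q$ elements and $U(\mathbb{F}_q)$ is its group of units (nonzero elements). $Q(\mathbb{F}_q)=\{a\in U(\mathbb{F}_q): a=x^2 \text{ for some } x\in\mathbb{F}_q\}$ and $N(\mathbb{F}_q)=U(\mathbb{F}_q)\setminus Q(\mathbb{F}_q)$. For $n\ge 1$, $ST_n(\mathbb{F}_q)$ is the set of $n\times n$ symmetric tridiagonal matrices over $\mathbb{F}_q$, i.e. symmetric matrices whose entries outside the main diagonal, the subdiagonal and the superdiagonal are zero. For $a\in\mathbb{F}_q$, $ST_n(\mathbb{F}_q,a)=\{A\in ST_n(\mathbb{F}_q):\det(A)=a\}$. *)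

(* Defs.v *)
From HB Require Import structures.
From mathcomp Require Import all_boot all_order all_algebra.

Set Implicit Arguments.
Unset Strict Implicit.
Unset Printing Implicit Defensive.

Import GRing.Theory.
Local Open Scope ring_scope.

Definition units (F : finFieldType) : {set F} := [set a | a \is a GRing.unit].

Definition Qset (F : finFieldType) : {set F} :=
  [set a in units F | [exists x : F, a == x ^+ 2]].

Definition Nset (F : finFieldType) : {set F} := units F :\: Qset F.

Definition tridiagonal (R : nmodType) (n : nat) (A : 'M[R]_n) : bool :=
  [forall i : 'I_n, forall j : 'I_n,
    [&& i != j :> nat, i != j.+1 :> nat & j != i.+1 :> nat] ==> (A i j == 0)].

Definition ST (F : finFieldType) (n : nat) : {set 'M[F]_n} :=
  [set A | (A^T == A) && tridiagonal A].

Definition STdet (F : finFieldType) (n : nat) (a : F) : {set 'M[F]_n} :=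
  [set A in ST F n | \det A == a].

(* Main.v *)
Require Import Defs.
From mathcomp Require Import all_boot all_order all_algebra.

(** For [c != 0] and [D = diag(c, 1, ..., 1)], the congruence [A |-> D A D] is
    an injection of symmetric tridiagonal matrices multiplying determinants by
    [c ^+ 2]; so [#|STdet n a|] depends only on [a] modulo nonzero squares.
    Squaring is at most two-to-one on units, so at least half of the units are
    squares, and the nonsquares form at most one class. *)

Import GRing.Theory.
Local Open Scope ring_scope.

Lemma mem_Nset {F : finFieldType} {a : F} :
  a \in Nset F -> a != 0 /\ forall x, a <> x ^+ 2.
Proof.
rewrite !inE negb_and => /andP[/orP[/negP //|/existsPn nsq] ua].
by rewrite -unitfE; split=> // x ax; case/eqP: (nsq x).
Qed.

Lemma card_units_le_double_Qset (F : finFieldType) :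
  (#|units F| <= #|Qset F|.*2)%N.
Proof.
rewrite -sum1_card (partition_big (fun x => x ^+ 2) (mem (Qset F))) /=; last first.
  by move=> x; rewrite !inE => ux; rewrite unitrX //; apply/existsP; exists x.
rewrite -muln2 -sum_nat_const; apply: leq_sum => y.
rewrite inE => /andP[_ /existsP[z /eqP ->]].
(* The fibre of squaring over [z ^+ 2] lies in [[set z; - z]], which collapses to one point in
   characteristic 2; hence a bound, not an equality. *)
rewrite sum1_card; apply: leq_trans (_ : #|[set z; - z]| <= 2)%N.
  by apply/subset_leq_card/subsetP => x; rewrite unfold_in !inE eqf_sqr => /andP[].
by rewrite cards2; case: eqP.
Qed.

(** The coset [b * Qset F] has as many elements as [Qset F] and is disjoint from it, since
    [x ^+ 2 = b * w ^+ 2] would make [b] the square of [x / w]. By the counting bound the two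
    together exhaust the units, so a nonsquare [a] falls in the coset. *)
Lemma Nset_square_class (F : finFieldType) (a b : F) :
  a \in Nset F -> b \in Nset F -> exists2 c, c != 0 & a = c ^+ 2 * b.
Proof.
move=> Na Nb; have [a0 nsa] := mem_Nset Na; have [b0 nsb] := mem_Nset Nb.
pose bQ := [set b * y | y in Qset F].
have cardbQ : #|bQ| = #|Qset F| by rewrite card_imset //; apply: mulfI.
have dis : Qset F :&: bQ = set0.
  apply/setP => y; rewrite in_set0; apply/negbTE/negP => /setIP[].
  rewrite inE => /andP[_ /existsP[x /eqP ->]] /imsetP[z].
  rewrite !inE unitfE => /andP[z0 /existsP[w /eqP zw]] xz.
  by apply: (nsb (x / w)); rewrite expr_div_n xz -zw mulfK.
have subU : Qset F :|: bQ \subset units F.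
  apply/subsetP => y /setUP[|/imsetP[z + ->]]; rewrite !inE => /andP[uz _] //.
  by rewrite unitrM uz unitfE b0.
have eqU : Qset F :|: bQ = units F.
  apply/eqP; rewrite eqEcard subU cardsU dis cards0 subn0 cardbQ addnn.
  exact: card_units_le_double_Qset.
have : a \in Qset F :|: bQ by rewrite eqU inE unitfE.
rewrite in_setU => /orP[|/imsetP[z]].
  by rewrite inE => /andP[_ /existsP[x /eqP /nsa]].
rewrite !inE unitfE => /andP[z0 /existsP[w /eqP zw]] ->.
by exists w; [rewrite -sqrf_eq0 -zw | rewrite mulrC zw].
Qed.

(** Size [n.+1] provides the index 0 that carries [c], so that [diag_mx d] has determinant [c]. *)
Lemma leq_card_STdet_sqr (F : finFieldType) (n : nat) (a c : F) :
  c != 0 -> (#|STdet n.+1 a| <= #|STdet n.+1 (c ^+ 2 * a)%R|)%N.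
Proof.
move=> c0; pose d : 'rV[F]_n.+1 := \row_i (if i == 0 then c else 1).
have detd : \det (diag_mx d) = c.
  by rewrite det_diag big_ord_recl mxE /= big1 ?mulr1 // => i _; rewrite mxE.
pose f (A : 'M[F]_n.+1) := diag_mx d *m A *m diag_mx d.
have ud : diag_mx d \in unitmx by rewrite unitmxE detd unitfE.
have injf : injective f.
  by move=> A B /(can_inj (mulmxK ud)) /(can_inj (mulKmx ud)).
rewrite -(card_imset _ injf); apply/subset_leq_card/subsetP => _ /imsetP[A + ->].
rewrite !inE => /andP[/andP[/eqP symA /forallP triA] /eqP detA].
apply/andP; split; last by rewrite !det_mulmx detd detA mulrAC expr2.
rewrite !trmx_mul tr_diag_mx symA mulmxA eqxx /=.
(* The congruence scales entry [(i, j)] by [d_i * d_j], so zeros off the three diagonals persist. *)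
apply/forallP => i; apply/forallP => j; apply/implyP => ij.
have /forallP/(_ j)/implyP/(_ ij)/eqP Aij := triA i.
by rewrite /f mul_mx_diag mul_diag_mx !mxE Aij mulr0 mul0r.
Qed.

(** The reverse inequality is the same injection for [c^-1], starting from determinant
    [c ^+ 2 * a]. *)
Lemma card_STdet_sqr (F : finFieldType) (n : nat) (a c : F) :
  c != 0 -> #|STdet n.+1 (c ^+ 2 * a)%R| = #|STdet n.+1 a|.
Proof.
move=> c0; apply/eqP; rewrite eqn_leq leq_card_STdet_sqr // andbT.
have := @leq_card_STdet_sqr F n (c ^+ 2 * a) c^-1.
by rewrite invr_eq0 mulrA -exprMn mulVf // expr1n mul1r => /(_ c0).
Qed.

Theorem theorem2p12 (n : nat) (hn : (0 < n)%N) (F : finFieldType)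
  (a : F) (ha : a \in units F) :
  (a \in Qset F -> #|STdet n a| = #|STdet n (1%R : F)|) /\
  (forall b : F, b \in Nset F -> a \in Nset F -> #|STdet n a| = #|STdet n b|).
Proof.
case: n hn => // n _; split=> [|b Nb Na].
  rewrite !inE unitfE => /andP[a0 /existsP[x /eqP ax]].
  by rewrite ax -[x ^+ 2]mulr1 card_STdet_sqr // -sqrf_eq0 -ax.
by have [c c0 ->] := Nset_square_class _ _ _ Na Nb; rewrite card_STdet_sqr.
Qed.
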